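(* Let $f=f_{asyche}:D_{(x,y)}\to\mathbb R^3$ be a $C^{1M}$ regular immersion in asymptotic Chebyshev coordinates, and let $\theta$, the angle from $f_x$ to $f_y$, satisfy $0<\theta<\pi$. Assume that $N=N_{asyche}:=\dfrac{f_x\times f_y}{\sin\theta}$ is $C^{1M}$, that $N_{xy}=N_{yx}=\cos\theta\,N$, and that $f_x=N\times N_x$ and $f_y=-N\times N_y$. Then, locally, there is a $C^1$ reparametrization $f_{graph}=f_{asyche}\circ S$ of $f_{asyche}$ with $f_{graph}$ of class $C^2$; that is, every point of $D_{(x,y)}$ has an open neighbourhood $\breve D_{(x,y)}$ for which there are an open set $\breve D_{(u,v)}\subset\mathbb R^2$ and a $C^1$ diffeomorphism $S:\breve D_{(u,v)}\to\breve D_{(x,y)}$ such that $f_{asyche}\circ S$ is $C^2$.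
   Context: $D_{(x,y)}\subset\mathbb R^2$ is a simply connected open set with coordinates $(x,y)$. A $C^1$ map $g$ is $C^{1M}$ if its mixed second partials $g_{xy},g_{yx}$ exist, are continuous and are equal. A $C^1$ map is regular if it has rank $2$ everywhere. $f$ is Chebyshev if $\langle f_x,f_x\rangle=\langle f_y,f_y\rangle=1$ and asymptotic if $\langle f_x,N_x\rangle=0=\langle f_y,N_y\rangle$. *)

(* Defs.v *)
From HB Require Import structures.
From mathcomp Require Import all_boot all_order all_algebra.
From mathcomp Require Import all_classical all_reals all_analysis.

Set Implicit Arguments.
Unset Strict Implicit.
Unset Printing Implicit Defensive.

Import Order.TTheory GRing.Theory Num.Theory.
Import numFieldNormedType.Exports.

Local Open Scope classical_set_scope.
Local Open Scope ring_scope.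

(* Points and vectors of R^n are row vectors 'rV[R]_n.  A map
   on an open set D is a total function of which only the values on D matter:
   as D is open, differentiability and continuity at p \in D depend only on
   the restriction to D. *)

Section Topology.
Context {R : realType} {T : topologicalType}.
Implicit Types (A : set T) (g : R -> T).

Local Notation I01 := (`[0, 1]%classic : set R).

Definition path_in A g : Prop :=
  {within I01, continuous g} /\ g @` I01 `<=` A.

Definition path_connected A : Prop :=
  forall x y, A x -> A y ->
    exists g, [/\ path_in A g, g 0 = x & g 1 = y].

(* g is homotopic in A, relative to its endpoints, to the constant loop *)
Definition null_homotopic A g : Prop :=
  exists H : R * R -> T,
    [/\ {within I01 `*` I01, continuous H},
        H @` (I01 `*` I01) `<=` A,
        forall s, I01 s -> H (s, 0) = g s /\ H (s, 1) = g 0 &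
        forall t, I01 t -> H (0, t) = g 0 /\ H (1, t) = g 0].

Definition simply_connected A : Prop :=
  path_connected A /\
  forall g, path_in A g -> g 0 = g 1 -> null_homotopic A g.

End Topology.

Arguments path_connected R {T} A.
Arguments simply_connected R {T} A.

Section Smoothness.
Context {R : realType}.

Definition partial n m (i : 'I_n) (f : 'rV[R]_n -> 'rV[R]_m) :
  'rV[R]_n -> 'rV[R]_m := fun p => 'D_(delta_mx 0 i) f p.

Definition class_C1 n m (D : set 'rV[R]_n) (f : 'rV[R]_n -> 'rV[R]_m) : Prop :=
  forall p, D p ->
    differentiable f p /\ forall i, {for p, continuous (partial i f)}.

Definition class_C2 n m (D : set 'rV[R]_n) (f : 'rV[R]_n -> 'rV[R]_m) : Prop :=
  class_C1 D f /\ forall i, class_C1 D (partial i f).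

Definition C1_diffeo n (U V : set 'rV[R]_n) (S : 'rV[R]_n -> 'rV[R]_n) : Prop :=
  [/\ set_bij U V S, class_C1 U S &
      exists T, (forall p, U p -> T (S p) = p) /\ class_C1 V T].

End Smoothness.

Section Surfaces.
Context {R : realType}.
Implicit Types (D : set 'rV[R]_2) (f N : 'rV[R]_2 -> 'rV[R]_3).

Definition ddx m (f : 'rV[R]_2 -> 'rV[R]_m) := partial 0 f.
Definition ddy m (f : 'rV[R]_2 -> 'rV[R]_m) := partial 1 f.

(* f_xy is [ddy (ddx f)] and f_yx is [ddx (ddy f)]; since ['D_v f p] is total,
   the existence of the limits is required separately. *)
Definition class_C1M m D (f : 'rV[R]_2 -> 'rV[R]_m) : Prop :=
  class_C1 D f /\
  forall p, D p ->
    [/\ derivable (ddx f) p (delta_mx 0 1),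
        derivable (ddy f) p (delta_mx 0 0),
        {for p, continuous (ddy (ddx f))},
        {for p, continuous (ddx (ddy f))} &
        ddy (ddx f) p = ddx (ddy f) p].

Definition regular D f : Prop :=
  class_C1 D f /\ forall p, D p -> \rank ('J f p) = 2%N.

Definition dotp n (u v : 'rV[R]_n) : R := \sum_i u 0 i * v 0 i.

(* The norm [`|u|] on row vectors is the sup norm. *)
Definition enorm n (u : 'rV[R]_n) : R := Num.sqrt (dotp u u).

Definition crossp (u v : 'rV[R]_3) : 'rV[R]_3 :=
  let c i j : R := u 0 i * v 0 j - u 0 j * v 0 i in
  \row_k [:: c 1 2%:R; c 2%:R 0; c 0 1]`_k.

(* With t in ]0, pi[ this determines t; t is then also the oriented angle from
   u to v in their span, oriented by [crossp u v]. *)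
Definition is_angle n (u v : 'rV[R]_n) (t : R) : Prop :=
  dotp u v = enorm u * enorm v * cos t.

Definition Chebyshev D f : Prop :=
  forall p, D p -> dotp (ddx f p) (ddx f p) = 1 /\
                   dotp (ddy f p) (ddy f p) = 1.

(* N is the normal field of f *)
Definition asymptotic D f N : Prop :=
  forall p, D p -> dotp (ddx f p) (ddx N p) = 0 /\
                   dotp (ddy f p) (ddy N p) = 0.

End Surfaces.

(* Main.v *)
Require Import Defs.
From HB Require Import structures.
From mathcomp Require Import all_boot all_order all_algebra.
From mathcomp Require Import all_classical all_reals all_analysis.
From mathcomp Require Import ring lra.

Set Implicit Arguments.
Unset Strict Implicit.
Unset Printing Implicit Defensive.

Import Order.TTheory GRing.Theory Num.Theory.
Import numFieldNormedType.Exports.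

Local Open Scope classical_set_scope.
Local Open Scope ring_scope.

(** A surface with a C1 unit normal becomes C2 once it is written as a graph.
    Near a given point some coordinate [N 0 k] of the normal does not vanish.
    Dropping the k-th coordinate of [f] then gives a map [F] between open
    subsets of the plane whose Jacobian is invertible: a tangent vector killed
    by the projection is a multiple of the k-th basis vector, and being
    orthogonal to [N] it is zero.  The inverse function theorem provides a C1
    local inverse [S] of [F], and [f \o S] is the graph parametrization of the
    surface over a coordinate plane.

    The partial derivatives of [f \o S] are the vectors orthogonal to the
    normal whose projections are the basis vectors of that plane.  They are
    therefore explicit quotients of coordinates of [N \o S] ([graph_mxP],
    [row_graph_mx]), so they are C1 although [S] and [f] are only C1.  This is
    [hypersurface_graph_C2], which holds in every dimension for an immersion
    with a nowhere vanishing C1 normal field.  In the situation at hand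
    orthogonality comes from the expression of [N] as a cross product, and
    [N] cannot vanish because [f_x], of length 1, is the cross product of [N]
    with [N_x].

    The inverse function theorem [inverse_function] is obtained from the
    Banach fixed point theorem: after composition with the inverse of the
    Jacobian at the base point, the map is a small Lipschitz perturbation of
    the identity ([mean_value_le]), hence it expands distances by at least
    1/2 ([near_id_expands]) and is open ([near_id_open_image]).
    Differentiability of the inverse is [jacobian_inverse]. *)

(** * Norm and continuity of matrix operations *)

(** Needed to apply the Banach fixed point theorem to row vectors. *)
HB.instance Definition _ (R : realType) m n := Complete.on 'M[R]_(m, n).

Section MatrixNorm.
Context {R : realType}.

Lemma ler_mx_coef m n (A : 'M[R]_(m, n)) i j : `|A i j| <= `|A|.
Proof.
rewrite [leRHS]/Num.Def.normr/= mx_normrE.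
exact: (le_bigmax _ (fun ij => `|A ij.1 ij.2|) (i, j)).
Qed.

Lemma mx_norm_le m n (A : 'M[R]_(m, n)) e :
  0 <= e -> (forall i j, `|A i j| <= e) -> `|A| <= e.
Proof.
move=> e0 Ae; rewrite [leLHS]/Num.Def.normr/= mx_normrE.
by apply: bigmax_le => // -[i j] _; exact: Ae.
Qed.

(** The norm of a matrix is the maximum of the absolute values of its
    coefficients, which is submultiplicative only up to the inner dimension. *)
Lemma mx_normM m n q (A : 'M[R]_(m, n)) (B : 'M[R]_(n, q)) :
  `|A *m B| <= n%:R * `|A| * `|B|.
Proof.
apply: mx_norm_le => [|i j]; first by rewrite !mulr_ge0.
rewrite mxE (le_trans (ler_norm_sum _ _ _))//.
rewrite (@le_trans _ _ (\sum_(k < n) `|A| * `|B|))//.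
  by apply: ler_sum => k _; rewrite normrM ler_pM// ler_mx_coef.
by rewrite sumr_const card_ord -mulrA mulr_natl.
Qed.

End MatrixNorm.

Section MatrixContinuity.
Context {R : realType} {T : Type} (F : set_system T) {FF : Filter F}.

Lemma cvg_mx m n (f : T -> 'M[R]_(m, n)) (A : 'M[R]_(m, n)) :
  (forall i j, f x i j @[x --> F] --> A i j) -> f x @[x --> F] --> A.
Proof.
move=> fA; apply/cvgrPdist_le => e e0; near=> x.
apply: mx_norm_le (ltW e0) _ => i j; rewrite !mxE.
move: i j; near: x.
apply: filter_forall => i; apply: filter_forall => j.
by move/cvgrPdist_le : (fA i j); apply.
Unshelve. all: by end_near. Qed.

Lemma cvg_mx_coef m n (f : T -> 'M[R]_(m, n)) (A : 'M[R]_(m, n)) i j :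
  f x @[x --> F] --> A -> f x i j @[x --> F] --> A i j.
Proof.
move=> fA; apply: (cvg_comp f (fun M : 'M[R]_(m, n) => M i j) fA).
exact: (@coord_continuous _ _ _ i j A).
Qed.

Lemma cvg_mulmx m n q (f : T -> 'M[R]_(m, n))
    (g : T -> 'M[R]_(n, q)) (A : 'M[R]_(m, n)) (B : 'M[R]_(n, q)) :
  f x @[x --> F] --> A -> g x @[x --> F] --> B ->
  f x *m g x @[x --> F] --> A *m B.
Proof.
move=> fA gB; apply: cvg_mx => i j.
rewrite mxE; under eq_cvg do rewrite mxE.
apply: cvg_big => [|k _]; first exact: add_continuous.
by apply: cvgM; [exact: cvg_mx_coef fA | exact: cvg_mx_coef gB].
Qed.

Lemma cvg_det n (f : T -> 'M[R]_n) (A : 'M[R]_n) :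
  f x @[x --> F] --> A -> \det (f x) @[x --> F] --> \det A.
Proof.
move=> fA; apply: cvg_big => [|s _]; first exact: add_continuous.
apply: cvgM; first exact: cvg_cst.
apply: cvg_big => [|i _]; first exact: mul_continuous.
exact: cvg_mx_coef fA.
Qed.

Lemma near_unitmx n (f : T -> 'M[R]_n) (A : 'M[R]_n) :
  A \in unitmx -> f x @[x --> F] --> A -> \forall x \near F, f x \in unitmx.
Proof.
rewrite unitmxE unitfE => A0 /cvg_det fA.
near=> x; rewrite unitmxE unitfE; near: x; exact: cvgr_neq0 fA A0.
Unshelve. all: by end_near. Qed.

(** By Cramer's rule: the inverse is the adjugate divided by the determinant,
    and both are polynomial in the coefficients.  Near [A] the matrices are
    invertible, so that [invmx] is really this quotient there. *)
Lemma cvg_invmx n (f : T -> 'M[R]_n) (A : 'M[R]_n) : A \in unitmx ->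
  f x @[x --> F] --> A -> invmx (f x) @[x --> F] --> invmx A.
Proof.
move=> uA fA; rewrite {2}/invmx uA.
have uf := near_unitmx uA fA.
apply: (@cvg_trans _ (((\det (f x))^-1 *: \adj (f x)) @[x --> F])).
  apply: near_eq_cvg; near=> x; rewrite /invmx ifT//.
  by near: x; exact: uf.
apply: cvgZ.
  by apply: cvgV; [rewrite -unitfE -unitmxE | exact: cvg_det].
apply: cvg_mx => i j; rewrite !mxE; under eq_cvg do rewrite !mxE.
apply: cvgM; first exact: cvg_cst.
apply: cvg_det; apply: cvg_mx => i' j'; rewrite !mxE.
by under eq_cvg do rewrite !mxE; exact: cvg_mx_coef fA.
Unshelve. all: by end_near. Qed.

End MatrixContinuity.

(** * Jacobian matrices and maps of class C1 *)

Section Jacobian.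
Context {R : realType}.
Implicit Types n m q : nat.

Lemma mulmxr_continuous n m q (M : 'M[R]_(n, m)) :
  continuous (fun h : 'M[R]_(q, n) => h *m M).
Proof.
move=> h; apply: (@cvg_mulmx _ _ (nbhs h) _ _ _ _ id (fun=> M)) => //.
exact: cvg_cst.
Qed.

(** This lemma and the next one trade the Landau notation for
    an explicit epsilon, in which Jacobians can be identified by estimates. *)
Lemma jacobian_approx n m (f : 'rV[R]_n -> 'rV[R]_m) x e :
  differentiable f x -> 0 < e ->
  \forall h \near (0 : 'rV[R]_n),
    `|f (h + x) - f x - h *m 'J f x| <= e * `|h|.
Proof.
move=> df e0; have /eqaddoE/eqaddoP/(_ e e0) := diff_locally df.
apply: filterS => h.
by rewrite /jacobian mul_rV_lin1 /= !fctE opprD addrA.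
Qed.

Lemma jacobian_unique n m (f : 'rV[R]_n -> 'rV[R]_m) x (M : 'M[R]_(n, m)) :
  (forall e, 0 < e -> \forall h \near (0 : 'rV[R]_n),
    `|f (h + x) - f x - h *m M| <= e * `|h|) ->
  differentiable f x /\ 'J f x = M.
Proof.
move=> fM.
have cM : continuous (mulmxr M : {linear 'rV[R]_n -> 'rV[R]_m}).
  exact: mulmxr_continuous.
have fE : f \o shift x =
    cst (f x) + (mulmxr M : 'rV[R]_n -> 'rV[R]_m) +o_ (0 : 'rV[R]_n) id.
  apply/eqaddoP => e e0; apply: filterS (fM _ e0) => h.
  by rewrite /= !fctE opprD addrA.
have dE := diff_unique cM fE; split.
  by apply/diff_locallyP; rewrite dE; split.
apply/matrixP => i j.
by rewrite /jacobian mxE dE /= -rowE mxE.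
Qed.

Lemma jacobian_comp n m q (f : 'rV[R]_n -> 'rV[R]_m) (g : 'rV[R]_m -> 'rV[R]_q)
    x :
  differentiable f x -> differentiable g (f x) ->
  'J (g \o f) x = 'J f x *m 'J g (f x).
Proof.
move=> df dg; apply/row_matrixP => i.
by rewrite !rowE mulmxA /jacobian !mul_rV_lin1 diff_comp.
Qed.

Lemma jacobian_mulmxr n m (M : 'M[R]_(n, m)) x :
  differentiable (fun y : 'rV[R]_n => y *m M) x /\
  'J (fun y : 'rV[R]_n => y *m M) x = M.
Proof.
apply: jacobian_unique => e e0; near=> h.
by rewrite mulmxDl addrK subrr normr0 mulr_ge0// ltW.
Unshelve. all: by end_near. Qed.

Lemma jacobian_near n m (f g : 'rV[R]_n -> 'rV[R]_m) x :
  (\forall y \near x, f y = g y) -> differentiable f x ->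
  differentiable g x /\ 'J g x = 'J f x.
Proof.
move=> fg df; apply: jacobian_unique => e e0.
have fg0 : \forall h \near (0 : 'rV[R]_n), f (h + x) = g (h + x).
  by rewrite (near_shift x); apply: filterS fg => y; rewrite /= sub0r subrK.
apply: filterS2 fg0 (jacobian_approx df e0) => h <-.
by rewrite (nbhs_singleton fg).
Qed.

Lemma partialE n m (f : 'rV[R]_n -> 'rV[R]_m) x i :
  differentiable f x -> partial i f x = row i ('J f x).
Proof. by move=> df; rewrite /partial deriveEjacobian// rowE. Qed.

Lemma partial_coef n m (f : 'rV[R]_n -> 'rV[R]_m) x i j :
  differentiable f x -> partial i f x 0 j = 'J f x i j.
Proof. by move=> df; rewrite partialE// [LHS]mxE. Qed.

(** Since [D] is open, [f] is differentiable around each of its points, where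
    the partial derivatives are the rows of the Jacobian; this is what makes
    the chain rule usable for maps of class C1. *)
Lemma class_C1P n m (D : set 'rV[R]_n) (f : 'rV[R]_n -> 'rV[R]_m) :
  open D -> class_C1 D f <->
  (forall p, D p -> differentiable f p /\ {for p, continuous (jacobian f)}).
Proof.
move=> oD.
have near_D p : D p -> \forall y \near p, D y.
  by move=> Dp; exact: open_nbhs_nbhs.
split=> fC p Dp; have [df cf] := fC p Dp; split=> //.
  apply: (@cvg_mx _ _ (nbhs p)) => i j.
  apply: (@cvg_trans _ (partial i f y 0 j @[y --> p])).
    apply: near_eq_cvg; near=> y.
    rewrite partial_coef//; apply: (fC _ _).1; near: y; exact: near_D.
  rewrite -(partial_coef i j df).
  exact: cvg_mx_coef (cf i).
move=> i; apply: (@cvg_mx _ _ (nbhs p)) => k j.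
apply: (@cvg_trans _ ('J f y i j @[y --> p])).
  apply: near_eq_cvg; near=> y; rewrite ord1.
  rewrite partial_coef//; apply: (fC _ _).1; near: y; exact: near_D.
rewrite ord1 (partial_coef i j df); exact: cvg_mx_coef cf.
Unshelve. all: by end_near. Qed.

Lemma class_C1_eq n m (D : set 'rV[R]_n) (f g : 'rV[R]_n -> 'rV[R]_m) :
  open D -> (forall p, D p -> f p = g p) -> class_C1 D f -> class_C1 D g.
Proof.
move=> oD fg /(class_C1P _ oD) fC; apply/(class_C1P _ oD) => p Dp.
have near_D (z : 'rV[R]_n) : D z -> \forall y \near z, f y = g y.
  by move=> Dz; apply: filterS (open_nbhs_nbhs (conj oD Dz)) => y; exact: fg.
have [df cf] := fC p Dp; have [dg Jg] := jacobian_near (near_D p Dp) df.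
split; first exact: dg.
rewrite /prop_for /continuous_at Jg.
apply: cvg_trans cf; apply: (@near_eq_cvg _ _ (nbhs p)).
have := open_nbhs_nbhs (conj oD Dp).
apply: filterS => y Dy.
have [dfy _] := fC y Dy.
have [_ Jgy] := jacobian_near (near_D y Dy) dfy.
exact: esym Jgy.
Qed.

Lemma class_C1_comp n m q (D : set 'rV[R]_n) (E : set 'rV[R]_m)
    (f : 'rV[R]_n -> 'rV[R]_m) (g : 'rV[R]_m -> 'rV[R]_q) :
  open D -> open E -> (forall p, D p -> E (f p)) ->
  class_C1 D f -> class_C1 E g -> class_C1 D (g \o f).
Proof.
move=> oD oE DE /(class_C1P _ oD) fC /(class_C1P _ oE) gC.
apply/(class_C1P _ oD) => p Dp.
have [df cf] := fC p Dp; have [dg cg] := gC _ (DE _ Dp).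
split; first exact: differentiable_comp.
rewrite /prop_for /continuous_at jacobian_comp//.
apply: (@cvg_trans _ ('J f y *m 'J g (f y) @[y --> p])).
  apply: (@near_eq_cvg _ _ (nbhs p)).
  apply: filterS (open_nbhs_nbhs (conj oD Dp)) => y Dy.
  by rewrite jacobian_comp//; [exact: (fC _ Dy).1 | exact: (gC _ (DE _ Dy)).1].
apply: (@cvg_mulmx _ _ (nbhs p)) => //.
exact: (continuous_comp (differentiable_continuous df) cg).
Unshelve. all: by end_near. Qed.

End Jacobian.

(** * Mean value inequality *)

Section InverseFunction.
Context {R : realType}.
Implicit Types n m : nat.

Lemma is_derive_line (V W : normedModType R) (f : V -> W) (x v : V) (t : R) :
  derivable f (t *: v + x) v ->
  is_derive t 1 (fun s : R => f (s *: v + x)) ('D_v f (t *: v + x)).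
Proof.
have E : (fun h : R => h^-1 *: (f ((h *: 1 + t) *: v + x) - f (t *: v + x))) =
         (fun h : R => h^-1 *: (f (h *: v + (t *: v + x)) - f (t *: v + x))).
  by apply/funext => h; rewrite scalerDl scaler1 addrA.
move=> df; apply: DeriveDef.
  by rewrite /derivable /= E.
by rewrite /derive /= E.
Qed.

Lemma ball_segment (V : normedModType R) (p x y : V) (r t : R) :
  ball p r x -> ball p r y -> 0 <= t <= 1 -> ball p r (t *: (y - x) + x).
Proof.
rewrite -!ball_normE /ball_/= => px py /andP[t0 t1].
have -> : p - (t *: (y - x) + x) = (1 - t) *: (p - x) + t *: (p - y).
  have -> : y - x = (p - x) - (p - y) by rewrite opprB [RHS]addrC addrA subrK.
  rewrite scalerBl scale1r scalerBr !opprD opprK.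
  by rewrite [X in p + X]addrC !addrA.
apply: le_lt_trans (ler_normD _ _) _.
rewrite !normrZ (ger0_norm t0) ger0_norm ?subr_ge0//.
have [->|t_neq1] := eqVneq t 1; first by rewrite subrr mul0r add0r mul1r.
have -> : r = (1 - t) * r + t * r by rewrite mulrBl mul1r subrK.
apply: ltr_leD; first by rewrite ltr_pM2l// subr_gt0 lt_neqAle t_neq1.
by apply: ler_wpM2l => //; exact: ltW.
Qed.

(** The intermediate point depends on the coordinate [j], so that the equality
    holds coordinate by coordinate only; the estimate [mean_value_le] suffers
    no loss from this because the norm is the maximum of the coordinates. *)
Lemma mean_value_coef n m (f : 'rV[R]_n -> 'rV[R]_m) (p x y : 'rV[R]_n)
    (r : R) j :
  (forall z, ball p r z -> differentiable f z) ->
  ball p r x -> ball p r y ->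
  exists2 z, ball p r z & (f y - f x) 0 j = ((y - x) *m 'J f z) 0 j.
Proof.
move=> df px py; pose l (t : R) := t *: (y - x) + x.
have bl (t : R) : 0 <= t <= 1 -> ball p r (l t) by exact: ball_segment.
have dl (t : R) : 0 <= t <= 1 ->
    is_derive t 1 (fun s => f (l s) 0 j) (((y - x) *m 'J f (l t)) 0 j).
  move=> t01; have dft := df _ (bl t t01).
  have Dft : derivable f (l t) (y - x) by exact: diff_derivable.
  have /derivable_mxP/(_ 0 j) Dfj := Dft.
  have := is_derive_line Dfj.
  suff -> : 'D_(y - x) (fun z => f z 0 j) (l t) = ((y - x) *m 'J f (l t)) 0 j.
    by [].
  by rewrite -(deriveEjacobian _ dft) (derive_mx Dft) mxE.
have [||c] := @MVT_segment R (fun s => f (l s) 0 j)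
    (fun t => ((y - x) *m 'J f (l t)) 0 j) 0 1 ler01.
- by move=> t; rewrite in_itv/= => /andP[t0 t1]; apply: dl; rewrite !ltW.
- apply: derivable_within_continuous => t; rewrite in_itv/= => t01.
  exact: (@ex_derive _ _ _ _ _ _ _ (dl t t01)).
rewrite in_itv/= => c01.
rewrite subr0 mulr1 {1 2}/l scale1r scale0r add0r subrK.
by move=> E; exists (l c); [exact: bl | rewrite -E !mxE].
Qed.

(** Strict differentiability: if the Jacobian stays [e]-close to a fixed matrix
    on a ball, then [f] is linear up to a Lipschitz error of order [e],
    uniformly in pairs of points of the ball. *)
Lemma mean_value_le n m (f : 'rV[R]_n -> 'rV[R]_m) (p : 'rV[R]_n) (r : R)
    (A : 'M[R]_(n, m)) (e : R) :
  (forall z, ball p r z -> differentiable f z) ->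
  (forall z, ball p r z -> `|'J f z - A| <= e) ->
  forall x y, ball p r x -> ball p r y ->
  `|f y - f x - (y - x) *m A| <= n%:R * `|y - x| * e.
Proof.
move=> df fA x y px py.
have e0 : 0 <= e by exact: le_trans (fA x px).
apply: mx_norm_le => [|i j]; first by rewrite !mulr_ge0.
rewrite ord1; have [z pz fz] := mean_value_coef j df px py.
rewrite mxE fz [X in _ + X]mxE.
have -> : ((y - x) *m 'J f z) 0 j - ((y - x) *m A) 0 j =
    ((y - x) *m ('J f z - A)) 0 j.
  by rewrite mulmxBr [RHS]mxE [X in _ = _ + X]mxE.
apply: (le_trans (ler_mx_coef _ _ _)); apply: (le_trans (mx_normM _ _)).
by rewrite ler_wpM2l ?mulr_ge0//; exact: fA.
Qed.

End InverseFunction.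

(** * Lipschitz perturbations of the identity *)

Lemma near_id_expands (R : realType) (X : normedModType R) (g : X -> X) x y :
  `|g y - g x - (y - x)| <= 2^-1 * `|y - x| -> `|y - x| <= 2 * `|g y - g x|.
Proof.
move=> gxy.
have := lerB_dist (y - x) (g y - g x); rewrite distrC => gxy'.
lra.
Qed.

(** To solve [g x = y] for [y] close to [g q], iterate
    [x |-> y + (x - g x)]: it is a contraction of ratio 1/2, and it maps a
    closed ball around [q] to itself when [y] is within half the radius of
    [g q]. *)
Lemma near_id_open_image (R : realType) (X : completeNormedModType R)
    (g : X -> X) (p : X) (r : R) :
  (forall x y, ball p r x -> ball p r y ->
    `|g y - g x - (y - x)| <= 2^-1 * `|y - x|) ->
  open (g @` ball p r).
Proof.
move=> gid; rewrite openE => _ [q pq <-].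
have /nbhs_closedballP[s sub_s] : nbhs q (ball p r).
  by apply: open_nbhs_nbhs; split => //; exact: ball_open.
have s0 : 0 < s%:num by [].
apply/nbhs_ballP; exists (s%:num / 2) => /=; first by rewrite divr_gt0.
move=> y gqy; have gy : `|g q - y| < s%:num / 2.
  by move: gqy; rewrite -ball_normE.
pose K (x : X) : X := y + (x - g x).
pose U := closed_ball q s%:num.
have Kcontr (x x' : X) : U x -> U x' -> `|K x - K x'| <= 2^-1 * `|x - x'|.
  move=> /sub_s px /sub_s px'; have := gid _ _ px' px.
  suff -> : K x - K x' = - (g x - g x' - (x - x')) by rewrite normrN.
  by rewrite /K opprD addrACA subrr add0r [RHS]opprB opprD addrACA -opprD.
have Uq : U q by exact: closed_ballxx.
have UK : {homo K : x / U x >-> U x}.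
  move=> x Ux; rewrite /U closed_ballE//= /closed_ball_/=.
  have := Kcontr _ _ Uq Ux.
  have : `|q - K q| <= s%:num / 2.
    by rewrite /K addrCA opprD addrA subrr add0r opprB ltW.
  move: Ux; rewrite /U closed_ballE//= /closed_ball_/= => qx Kq Kx.
  rewrite -(subrKA (K q)); apply: le_trans (ler_normD _ _) _.
  lra.
have Kfix : is_contraction (mkfun UK).
  exists (2^-1)%:nng; split => /=; first by lra.
  by move=> [x x'] [Ux Ux'] /=; exact: Kcontr.
have [||x Ux xE] := banach_fixed_point Kfix.
- exact: closed_ball_closed.
- by exists q.
exists x; first exact: sub_s.
move: xE; rewrite /= /mkfun /K addrCA -[LHS]addr0 => /addrI/esym/eqP.
by rewrite subr_eq0 => /eqP.
Qed.

(** * Inverse function theorem *)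

Section InverseFunctionTheorem.
Context {R : realType}.
Implicit Types n : nat.

(** With [k := T (h + F x) - x], differentiability of [F] says that
    [h = k *m 'J F x] up to an error negligible with respect to [k]; by the
    Lipschitz bound on [T] it is negligible with respect to [h] too, and
    multiplying by the inverse matrix gives the expansion of [T]. *)
Lemma jacobian_inverse n (F T : 'rV[R]_n -> 'rV[R]_n) (x : 'rV[R]_n) (C : R) :
  differentiable F x -> 'J F x \in unitmx -> 0 <= C -> T (F x) = x ->
  (\forall y \near F x, F (T y) = y) ->
  (\forall y \near F x, `|T y - x| <= C * `|y - F x|) ->
  differentiable T (F x) /\ 'J T (F x) = invmx ('J F x).
Proof.
move=> dF uJ C0 TFx FT lipT.
have near0 (P : 'rV[R]_n -> Prop) : (\forall y \near F x, P y) ->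
    \forall h \near (0 : 'rV[R]_n), P (h + F x).
  move=> FP; rewrite (near_shift (F x)); apply: filterS FP => y.
  by rewrite /= sub0r subrK.
have {}FT := near0 _ FT; have {}lipT := near0 _ lipT.
have T0 : T (h + F x) - x @[h --> (0 : 'rV[R]_n)] --> (0 : 'rV[R]_n).
  apply/(@cvgrPdist_le _ _ _ (nbhs (0 : 'rV[R]_n))) => e e0.
  have C1 : 0 < C + 1 by rewrite ltr_wpDl.
  have small : \forall h \near (0 : 'rV[R]_n), `|h| <= e / (C + 1).
    by apply: nbhs0_le; rewrite divr_gt0.
  apply: filterS2 lipT small => h; rewrite addrK sub0r normrN => Th he.
  apply: le_trans Th _; apply: (@le_trans _ _ ((C + 1) * `|h|)).
    by rewrite ler_wpM2r// lerDl.
  by rewrite mulrC -ler_pdivlMr.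
apply: jacobian_unique => e e0.
set M := invmx _; set c := n%:R * C * `|M| + 1.
have c0 : 0 < c by rewrite ltr_wpDl// !mulr_ge0.
have ec0 : 0 < e / c by rewrite divr_gt0.
have approx := T0 _ (jacobian_approx dF ec0).
apply: filterS (filterI (filterI FT lipT) approx) => h -[[FTh]].
rewrite /= addrK TFx subrK FTh addrK.
set k := T _ - x => Th hk.
have -> : k - h *m M = - ((h - k *m 'J F x) *m M).
  by rewrite mulmxBl mulmxK// opprB.
rewrite normrN; apply: le_trans (mx_normM _ _) _.
apply: (@le_trans _ _ (n%:R * (e / c * (C * `|h|)) * `|M|)).
  rewrite ler_wpM2r// ler_wpM2l//; apply: le_trans hk _.
  by rewrite ler_wpM2l// ltW.
have -> : n%:R * (e / c * (C * `|h|)) * `|M| =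
    (n%:R * C * `|M|) / c * (e * `|h|).
  ring.
apply: ler_piMl; first by rewrite mulr_ge0// ltW.
by rewrite ler_pdivrMr// mul1r lerDl.
Qed.

(** The radius of [U] is chosen so that on [U] the Jacobian is invertible and
    within [e] of its value at [p], with [e] small enough for
    [g x := F x *m invmx ('J F p)] to differ from the identity by a
    1/2-Lipschitz map. *)
Theorem inverse_function n (D : set 'rV[R]_n) (F : 'rV[R]_n -> 'rV[R]_n)
    (p : 'rV[R]_n) :
  open D -> class_C1 D F -> D p -> 'J F p \in unitmx ->
  exists U S, [/\ open U /\ U p, U `<=` D, open (F @` U) &
    C1_diffeo (F @` U) U S /\ forall y, (F @` U) y -> F (S y) = y].
Proof.
move=> oD FC1 Dp uJp.
have FC := (class_C1P _ oD).1 FC1.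
set A := 'J F p in uJp *; set B := invmx A.
pose c := n%:R * n%:R * `|B| + 1; pose e := (2 * c)^-1.
have c0 : 0 < c by rewrite ltr_wpDl// !mulr_ge0.
have e0 : 0 < e by rewrite invr_gt0 mulr_gt0.
have [dFp cJ] := FC p Dp.
have nearA : \forall z \near p, `|'J F z - A| <= e.
  exact: (cvgrPdistC_le (jacobian F) A).1 cJ e e0.
have nearU : \forall z \near p, 'J F z \in unitmx by exact: near_unitmx uJp cJ.
have nearD : \forall z \near p, D z by exact: (open_nbhs_nbhs (conj oD Dp)).
have [r /= r0 sub_r] :=
  (nbhs_ballP p _).1 (filterI (filterI nearA nearU) nearD).
pose U := ball p r.
have Up : U p by exact: ballxx.
have UD z : U z -> D z by move=> /sub_r[].
have Uu z : U z -> 'J F z \in unitmx by move=> /sub_r[[]].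
have UA z : U z -> `|'J F z - A| <= e by move=> /sub_r[[]].
have Ud z : U z -> differentiable F z by move=> /UD/FC[].
pose g x := F x *m B.
have gid x y : U x -> U y -> `|g y - g x - (y - x)| <= 2^-1 * `|y - x|.
  move=> Ux Uy.
  have -> : g y - g x - (y - x) = (F y - F x - (y - x) *m A) *m B.
    by rewrite mulmxBl mulmxK// mulmxBl.
  apply: le_trans (mx_normM _ _) _.
  apply: (@le_trans _ _ (n%:R * (n%:R * `|y - x| * e) * `|B|)).
    by rewrite ler_wpM2r// ler_wpM2l//; exact: (mean_value_le Ud UA).
  have -> : n%:R * (n%:R * `|y - x| * e) * `|B| =
      (n%:R * n%:R * `|B|) / c * (2^-1 * `|y - x|).
    rewrite /e invfM; ring.
  apply: ler_piMl; first by rewrite mulr_ge0.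
  by rewrite ler_pdivrMr// mul1r lerDl.
have lipF x y : U x -> U y -> `|y - x| <= 2 * n%:R * `|B| * `|F y - F x|.
  move=> Ux Uy; apply: le_trans (near_id_expands (gid _ _ Ux Uy)) _.
  rewrite /g -mulmxBl -!mulrA ler_wpM2l// (mulrC `|B|) mulrA.
  exact: mx_normM.
have injF x y : U x -> U y -> F x = F y -> x = y.
  move=> Ux Uy Fxy; apply/esym/eqP; rewrite -subr_eq0 -normr_le0.
  by apply: le_trans (lipF _ _ Ux Uy) _; rewrite Fxy subrr normr0 mulr0.
pose V := F @` U.
have oV : open V.
  have -> : V = (fun y => y *m B) @^-1` (g @` U).
    apply/seteqP; split=> y; first by move=> [x Ux <-]; exists x.
    move=> [x Ux /(congr1 (mulmx^~ A))].
    by rewrite /g !mulmxKV// => Fx; exists x.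
  apply: open_comp => [z _|]; first exact: mulmxr_continuous.
  exact: near_id_open_image gid.
pose S y := xget p [set x | U x /\ F x = y].
have SV y : V y -> U (S y) /\ F (S y) = y.
  by move=> [x Ux Fx]; apply: (@xgetPex _ p [set x | U x /\ F x = y]); exists x.
have SF x : U x -> S (F x) = x.
  move=> Ux; have [|US FS] := SV (F x); first by exists x.
  exact: injF.
have VF x : U x -> V (F x) by exists x.
have nearV y : V y -> \forall z \near y, V z.
  by move=> Vy; exact: (open_nbhs_nbhs (conj oV Vy)).
have SJ y : V y -> differentiable S y /\ 'J S y = invmx ('J F (S y)).
  move=> Vy; have [USy FSy] := SV y Vy.
  have FS : \forall z \near F (S y), F (S z) = z.
    by rewrite FSy; apply: filterS (nearV y Vy) => z /SV[].
  have lipS : \forall z \near F (S y),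
      `|S z - S y| <= 2 * n%:R * `|B| * `|z - F (S y)|.
    rewrite FSy; apply: filterS (nearV y Vy) => z /SV[USz FSz].
    by rewrite -{2}FSz -{2}FSy; exact: lipF.
  have C0 : 0 <= 2 * n%:R * `|B| by rewrite !mulr_ge0.
  have SFS : S (F (S y)) = S y by rewrite FSy.
  have := jacobian_inverse (Ud _ USy) (Uu _ USy) C0 SFS FS lipS.
  by rewrite FSy.
exists U, S; split => //.
- by split=> //; exact: ball_open.
split; last by move=> y /SV[].
split.
- split.
  + by move=> y /SV[].
  + move=> y z; rewrite !inE => /SV[_ Fy] /SV[_ Fz] Syz.
    by rewrite -Fy -Fz Syz.
  + by move=> x Ux; exists (F x); [exact: VF | exact: SF].
- apply/(class_C1P _ oV) => y Vy; have [dS JS] := SJ y Vy.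
  split; first exact: dS.
  rewrite /prop_for /continuous_at JS.
  apply: (@cvg_trans _ (invmx ('J F (S z)) @[z --> y])).
    apply: (@near_eq_cvg _ _ (nbhs y)); apply: filterS (nearV y Vy) => z Vz.
    by have [_ JSz] := SJ z Vz; exact: esym JSz.
  have [USy _] := SV y Vy.
  apply: (@cvg_invmx _ _ (nbhs y)); first exact: Uu.
  have [_ cJS] := FC _ (UD _ USy).
  exact: (continuous_comp (differentiable_continuous dS) cJS).
exists F; split=> [y /SV[]//|].
by move=> x /UD Dx; exact: FC1.
Qed.

End InverseFunctionTheorem.

(** * Tangent spaces as graphs *)

Section Graph.
Context {R : realType} {n : nat}.
Implicit Types (k : 'I_n.+1) (v : 'rV[R]_n.+1).

Definition drop_mx k : 'M[R]_(n.+1, n) := \matrix_(i, j) (i == lift k j)%:R.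

(** For [v] with nonzero k-th coordinate, the rows of this matrix form the basis
    of the hyperplane orthogonal to [v] which projects, when the k-th
    coordinate is dropped, to the standard basis: it is the Jacobian matrix of
    a parametrization as a graph of a hypersurface with normal [v]. *)
Definition graph_mx k v : 'M[R]_(n, n.+1) :=
  (drop_mx k)^T *m (1%:M - (v 0 k)^-1 *: (v^T *m delta_mx 0 k)).

Lemma drop_mx_trmx k : drop_mx k *m (drop_mx k)^T = 1%:M - delta_mx k k.
Proof.
apply/matrixP => i l; rewrite !mxE.
under eq_bigr do rewrite !mxE.
have [j ->|->] := unliftP k l; last first.
  rewrite big1 => [|j _]; first by rewrite eqxx andbT subrr.
  by rewrite (negbTE (neq_lift k j)) mulr0.
rewrite (bigD1 j)//= eqxx mulr1 big1 => [|j' jj']; last first.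
  by rewrite (inj_eq lift_inj) [j == j']eq_sym (negbTE jj') mulr0.
by rewrite [lift k j == k]eq_sym (negbTE (neq_lift k j)) andbF subr0 addr0.
Qed.

(** A vector orthogonal to [v] is determined by its coordinates other than the
    k-th: orthogonality gives the latter after division by [v 0 k]. *)
Lemma graph_mxP m k v (A : 'M[R]_(m, n.+1)) :
  v 0 k != 0 -> A *m v^T = 0 -> A *m drop_mx k *m graph_mx k v = A.
Proof.
move=> vk Av.
rewrite /graph_mx mulmxA -(mulmxA A) drop_mx_trmx.
have ev : delta_mx k k *m v^T = v 0 k *: delta_mx k 0 :> 'M[R]_(n.+1, 1).
  apply/matrixP => i j; rewrite ord1 !mxE (bigD1 k)//= big1 => [|l lk].
    by rewrite !mxE eqxx andbT addr0 mulrC.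
  by rewrite !mxE (negbTE lk) andbF mul0r.
have ee : (delta_mx k 0 : 'cV[R]_n.+1) *m (delta_mx 0 k : 'rV[R]_n.+1) =
    delta_mx k k.
  by rewrite mul_delta_mx.
have Bv : A *m (1%:M - delta_mx k k) *m v^T = - (v 0 k *: (A *m delta_mx k 0)).
  by rewrite -mulmxA mulmxBl mul1mx ev mulmxBr Av sub0r scalemxAr.
rewrite mulmxBr mulmx1 -scalemxAr mulmxA Bv mulNmx -scalemxAl -mulmxA ee.
by rewrite scalerN opprK scalerA mulVf// scale1r mulmxBr mulmx1 subrK.
Qed.

(** The projection along the k-th axis is injective on the orthogonal of [v],
    hence it preserves linear independence of vectors of this hyperplane. *)
Lemma unitmx_drop k v (A : 'M[R]_(n, n.+1)) :
  v 0 k != 0 -> A *m v^T = 0 -> row_free A -> A *m drop_mx k \in unitmx.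
Proof.
move=> vk Av; rewrite -row_free_unit -!kermx_eq0 => /eqP kA.
apply/eqP; have := mulmx_ker (A *m drop_mx k).
rewrite mulmxA => kD.
have : kermx (A *m drop_mx k) *m A = 0.
  rewrite -(graph_mxP (A := kermx _ *m A) vk) ?kD ?mul0mx//.
  by rewrite -mulmxA Av mulmx0.
by move=> /sub_kermxP; rewrite kA submx0 => /eqP.
Qed.

Lemma row_graph_mx k v i :
  row i (graph_mx k v) =
  delta_mx 0 (lift k i) - ((v 0 k)^-1 * v 0 (lift k i)) *: delta_mx 0 k.
Proof.
rewrite rowE mulmxA.
have -> : delta_mx 0 i *m (drop_mx k)^T = delta_mx 0 (lift k i) :> 'rV[R]_n.+1.
  by rewrite -rowE; apply/rowP => j; rewrite !mxE eqxx.
rewrite mulmxBr mulmx1 -scalemxAr mulmxA -rowE.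
have -> : row (lift k i) v^T = (v 0 (lift k i))%:M.
  by apply/matrixP => a b; rewrite !ord1 !mxE eqxx mulr1n.
by rewrite mul_scalar_mx scalerA.
Qed.

End Graph.

Section GraphC1.
Context {R : realType} {n : nat}.
Implicit Types (k : 'I_n.+1) (v : 'rV[R]_n.+1).

Lemma derive_coef k (p v : 'rV[R]_n.+1) :
  'D_v (fun z : 'rV[R]_n.+1 => z 0 k) p = v 0 k.
Proof.
have dI : derivable (@id 'rV[R]_n.+1) p v by exact: derivable_id.
have := derive_mx dI.
by rewrite derive_id => /matrixP/(_ 0 k); rewrite mxE.
Qed.

Lemma open_coef_neq0 k : open [set v : 'rV[R]_n.+1 | v 0 k != 0].
Proof.
rewrite openE => p /= pk; rewrite /interior.
exact: (cvgr_neq0 _ (@coord_continuous _ _ _ 0 k p) pk).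
Qed.

Lemma class_C1_row_graph_mx k i :
  class_C1 [set v : 'rV[R]_n.+1 | v 0 k != 0] (fun v => row i (graph_mx k v)).
Proof.
set l := lift k i.
set E := [set v | _].
pose w v : 'rV[R]_n.+1 :=
  delta_mx 0 l - ((v 0 k)^-1 * v 0 l) *: delta_mx 0 k.
have oE : open E by exact: open_coef_neq0.
suff : class_C1 E w.
  by apply: class_C1_eq => // p _; rewrite row_graph_mx.
pose q v := (v 0 k)^-1 * v 0 l.
have dc (j : 'I_n.+1) p : differentiable (fun z : 'rV[R]_n.+1 => z 0 j) p.
  exact: differentiable_coord.
have dV p : E p -> differentiable (fun z : 'rV[R]_n.+1 => (z 0 k)^-1) p.
  by move=> Ep; exact: differentiableV.
have dq p : E p -> differentiable q p.
  by move=> Ep; apply: differentiableM; [exact: dV | exact: dc].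
have dqZ p : E p ->
    differentiable (fun v => q v *: (delta_mx 0 k : 'rV[R]_n.+1)) p.
  by move=> Ep; apply: differentiableZl; exact: dq.
have dw p : E p -> differentiable w p.
  move=> Ep; apply: differentiableB; first exact: differentiable_cst.
  exact: dqZ.
pose dq' (u v : 'rV[R]_n.+1) :=
  (v 0 k)^-1 * u 0 l - v 0 l * ((v 0 k)^-2 * u 0 k).
have Dw u p : E p -> 'D_u w p = - dq' u p *: (delta_mx 0 k : 'rV[R]_n.+1).
  move=> Ep.
  have -> : w =
      cst (delta_mx 0 l) - (fun v => q v *: (delta_mx 0 k : 'rV[R]_n.+1)) by [].
  rewrite deriveB; [|exact: derivable_cst|exact/diff_derivable/dqZ].
  rewrite derive_cst sub0r scaleNr; congr (- _).
  rewrite (deriveE _ (dqZ _ Ep)) (diffZl _ (dq _ Ep)) -(deriveE _ (dq _ Ep)).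
  congr (_ *: _); rewrite /q.
  rewrite (deriveM (diff_derivable (dV _ Ep)) (diff_derivable (dc l p))).
  rewrite (deriveV Ep (diff_derivable (dc k p))) !derive_coef /dq'.
  by rewrite scaleNr scalerN.
move=> p Ep; split; first exact: dw.
move=> j; apply: (@cvg_trans _
  ((- dq' (delta_mx 0 j) z *: (delta_mx 0 k : 'rV[R]_n.+1)) @[z --> p])).
  apply: (@near_eq_cvg _ _ (nbhs p)).
  by apply: filterS (open_nbhs_nbhs (conj oE Ep)) => z Ez; rewrite /partial Dw.
rewrite /partial Dw//.
have cc (a : 'I_n.+1) : z 0 a @[z --> p] --> p 0 a by exact: coord_continuous.
have cV : (z 0 k)^-1 @[z --> p] --> (p 0 k)^-1 by exact: cvgV.
have cV2 : (z 0 k)^-2 @[z --> p] --> (p 0 k)^-2.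
  by rewrite -exprVn; under eq_cvg do rewrite -exprVn; exact: (cvgM cV cV).
pose u : 'rV[R]_n.+1 := delta_mx 0 j.
have cq : dq' u z @[z --> p] --> dq' u p.
  exact: (cvgB (cvgM cV (cvg_cst (u 0 l)))
    (cvgM (cc l) (cvgM cV2 (cvg_cst (u 0 k))))).
exact: (cvgZ (cvgN cq) (cvg_cst _)).
Qed.

End GraphC1.

(** * Hypersurfaces with a C1 normal *)

(** The normal field carries the missing derivative: the tangent hyperplane at
    a point is a C1 function of the parameters because its normal is, and in
    the coordinates of a graph it determines the partial derivatives. *)
Theorem hypersurface_graph_C2 (R : realType) (n : nat) (D : set 'rV[R]_n)
    (f N : 'rV[R]_n -> 'rV[R]_n.+1) :
  open D -> class_C1 D f -> class_C1 D N ->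
  (forall p, D p -> row_free ('J f p)) ->
  (forall p, D p -> N p != 0) ->
  (forall p, D p -> 'J f p *m (N p)^T = 0) ->
  forall p, D p ->
    exists (U V : set 'rV[R]_n) (S : 'rV[R]_n -> 'rV[R]_n),
      [/\ open U /\ U p, U `<=` D, open V,
          C1_diffeo V U S & class_C2 V (f \o S)].
Proof.
move=> oD fC1 NC1 freef N0 fN p Dp.
have /rV0Pn[k Npk] := N0 p Dp.
pose E := [set v : 'rV[R]_n.+1 | v 0 k != 0].
have oE : open E by exact: open_coef_neq0.
pose D' := D `&` N @^-1` E.
have oD' : open D'.
  rewrite openE => q [Dq Eq]; apply: filterI.
    exact: (open_nbhs_nbhs (conj oD Dq)).
  have cN : {for q, continuous N}.
    by apply: differentiable_continuous; exact: (NC1 q Dq).1.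
  exact: (cN E (open_nbhs_nbhs (conj oE Eq))).
have D'D q : D' q -> D q by case.
have dropC1 : class_C1 setT (fun y : 'rV[R]_n.+1 => y *m drop_mx k).
  apply/(class_C1P _ openT) => y _.
  have [dy Jy] := jacobian_mulmxr (drop_mx k : 'M[R]_(n.+1, n)) y.
  split; first exact: dy.
  have -> : jacobian (fun y : 'rV[R]_n.+1 => y *m drop_mx k) =
      cst (drop_mx k).
    by apply/funext => z; exact: (jacobian_mulmxr _ z).2.
  exact: (@cst_continuous _ _ (drop_mx k) y).
pose F x := f x *m drop_mx k.
have fC1' : class_C1 D' f by move=> q /D'D; exact: fC1.
have FC1 : class_C1 D' F := class_C1_comp oD' openT (fun _ _ => I) fC1' dropC1.
have uF : 'J F p \in unitmx.
  have -> : 'J F p = 'J f p *m drop_mx k.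
    have [dy Jy] := jacobian_mulmxr (drop_mx k : 'M[R]_(n.+1, n)) (f p).
    by rewrite -[in RHS]Jy; exact: (jacobian_comp (fC1 p Dp).1 dy).
  exact: (unitmx_drop Npk (fN p Dp) (freef p Dp)).
have D'p : D' p by [].
have [U [S [[oU Up] UD' oV [diffS FS]]]] := inverse_function oD' FC1 D'p uF.
set V := F @` U in oV diffS FS *.
have [bijS SC1 _] := diffS.
have VU y : V y -> U (S y) by case: bijS => + _ _; exact.
have VD y : V y -> D (S y) by move=> /VU/UD'/D'D.
have VE y : V y -> E (N (S y)) by move=> /VU/UD'[].
exists U, V, S; split => //; first by move=> q /UD'/D'D.
have fSC1 : class_C1 V (f \o S) := class_C1_comp oV oD VD SC1 fC1.
have NSC1 : class_C1 V (N \o S) := class_C1_comp oV oD VD SC1 NC1.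
split; first exact: fSC1.
(* The derivatives of [f \o S] are orthogonal to the normal, and dropping
   their k-th coordinate gives those of [F \o S], which is the identity. *)
have JfS y : V y -> 'J (f \o S) y = graph_mx k (N (S y)).
  move=> Vy; have dS : differentiable S y by exact: (SC1 y Vy).1.
  have df : differentiable f (S y) by exact: (fC1 _ (VD y Vy)).1.
  have dfS : differentiable (f \o S) y by exact: (fSC1 y Vy).1.
  have orth : 'J (f \o S) y *m (N (S y))^T = 0.
    have -> : 'J (f \o S) y = 'J S y *m 'J f (S y) by exact: jacobian_comp.
    by rewrite -mulmxA fN ?mulmx0//; exact: VD.
  rewrite -(graph_mxP (VE y Vy) orth).
  suff -> : 'J (f \o S) y *m drop_mx k = 1%:M by rewrite mul1mx.
  have [dd Jd] := jacobian_mulmxr (drop_mx k : 'M[R]_(n.+1, n)) (f (S y)).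
  have <- : 'J (F \o S) y = 'J (f \o S) y *m drop_mx k.
    by rewrite -[in RHS]Jd; exact: (jacobian_comp dfS dd).
  have [d1 J1] := jacobian_mulmxr (1%:M : 'M[R]_n) y.
  rewrite -[RHS]J1.
  apply: (jacobian_near _ d1).2.
  by apply: filterS (open_nbhs_nbhs (conj oV Vy)) => z Vz; rewrite mulmx1 /= FS.
move=> i.
have rowC1 := class_C1_comp oV oE VE NSC1 (@class_C1_row_graph_mx R n k i).
apply: (class_C1_eq oV _ rowC1) => y Vy.
by rewrite partialE ?JfS//; exact: (fSC1 y Vy).1.
Qed.

Lemma dotpE (R : realType) n (u v : 'rV[R]_n) : u *m v^T = (dotp u v)%:M.
Proof.
apply/matrixP => i j; rewrite !ord1 !mxE mulr1n /dotp.
by apply: eq_bigr => k _; rewrite !mxE.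
Qed.

Lemma dotp_crossp (R : realType) (u v : 'rV[R]_3) :
  dotp u (crossp u v) = 0 /\ dotp v (crossp u v) = 0.
Proof.
have e0 : ord0 = 0 :> 'I_3 by exact: val_inj.
have e1 : lift ord0 (ord0 : 'I_2) = 1 :> 'I_3 by exact: val_inj.
have e2 : lift ord0 (lift ord0 (ord0 : 'I_1)) = 2%:R :> 'I_3.
  exact: val_inj.
rewrite /dotp !big_ord_recl !big_ord0 !mxE /= e0 e1 e2.
by split; ring.
Qed.

Theorem theorem4p6 (R : realType) (D : set 'rV[R]_2)
    (f N : 'rV[R]_2 -> 'rV[R]_3) (theta : 'rV[R]_2 -> R)
    (openD : open D) (scD : simply_connected R D)
    (C1Mf : class_C1M D f) (regf : regular D f)
    (chebf : Chebyshev D f) (asyf : asymptotic D f N)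
    (angle_theta : forall p, D p -> is_angle (ddx f p) (ddy f p) (theta p))
    (theta_bounds : forall p, D p -> 0 < theta p < pi)
    (NE : forall p, D p ->
      N p = (sin (theta p))^-1 *: crossp (ddx f p) (ddy f p))
    (C1MN : class_C1M D N)
    (NxyE : forall p, D p -> ddy (ddx N) p = cos (theta p) *: N p)
    (NyxE : forall p, D p -> ddx (ddy N) p = cos (theta p) *: N p)
    (fxE : forall p, D p -> ddx f p = crossp (N p) (ddx N p))
    (fyE : forall p, D p -> ddy f p = - crossp (N p) (ddy N p)) :
  forall p, D p ->
    exists (Dxy Duv : set 'rV[R]_2) (S : 'rV[R]_2 -> 'rV[R]_2),
      [/\ open Dxy /\ Dxy p, Dxy `<=` D, open Duv,
          C1_diffeo Duv Dxy S & class_C2 Duv (f \o S)].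
Proof.
have [fC1 _] := C1Mf; have [NC1 _] := C1MN.
apply: (hypersurface_graph_C2 (N := N) openD fC1 NC1).
- by move=> p Dp; rewrite /row_free (regf.2 p Dp).
- move=> p Dp; apply/eqP => Np0.
  have := (chebf p Dp).1; rewrite fxE// Np0 => /eqP.
  rewrite /dotp !big_ord_recl big_ord0 !mxE /=.
  by rewrite !mul0r !subr0 !mul0r !addr0 eq_sym oner_eq0.
move=> p Dp; apply/row_matrixP => i; rewrite row0 row_mul.
rewrite -partialE; last exact: (fC1 p Dp).1.
rewrite NE// linearZ/= -scalemxAr dotpE.
have [dx dy] := dotp_crossp (ddx f p) (ddy f p).
suff -> : dotp (partial i f p) (crossp (ddx f p) (ddy f p)) = 0.
  by rewrite raddf0 scaler0.
have [->|->] : i = 0 \/ i = 1.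
- by case: i => [[|[|//]] ?]; [left|right]; exact: val_inj.
- exact: dx.
- exact: dy.
Qed.
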